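(* Let $\mathcal G$ be any ordered graph. Let $\mathcal G'$ be the ordered graph on $v(\mathcal G)+1$ vertices obtained from $\mathcal G$ by adding a single isolated vertex either to the right or to the left of all vertices of $\mathcal G$. Then $R(\mathcal G')=R(\mathcal G)+1$.
   Context: An ordered graph is a finite simple graph (with nonempty vertex set) with a linear ordering of its vertices; $v(\mathcal G)$ is its number of vertices. A copy of $\mathcal H$ in $\mathcal G$ is an order-preserving injection from the vertices of $\mathcal H$ to those of $\mathcal G$ that maps edges to edges. $R(\mathcal G)$ is the minimum $N$ such that every 2-coloring of the edges of the complete ordered graph on $N$ vertices contains a monochromatic copy of $\mathcal G$. ''Left'' and ''right'' mean smaller and larger in the vertex ordering. *)

(* Defs.v *)
From HB Require Import structures.
From mathcomp Require Import all_boot all_order.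
Set Implicit Arguments.
Unset Strict Implicit.
Unset Printing Implicit Defensive.

Import Order.TTheory.

Record ordered_graph := OrderedGraph {
  odisp : Order.disp_t;
  vertex :> finOrderType odisp;
  edge : rel vertex;
  edge_sym : symmetric edge;
  edge_irrefl : irreflexive edge;
  vertex_nonempty : 0 < #|vertex|
}.

(* Stated for bare relations, so that e' can be a colour class on 'I_N, where
   N may be 0. *)
Definition is_copy d d' (T : finOrderType d) (T' : finOrderType d')
    (e : rel T) (e' : rel T') (f : {ffun T -> T'}) : bool :=
  [&& injectiveb f,
      [forall x, forall y, (x <= y)%O ==> (f x <= f y)%O]
    & [forall x, forall y, e x y ==> e' (f x) (f y)]].

(* A 2-colouring of the edges of the complete ordered graph on 'I_N. An edge is
   the set of its two ends; only the values on two-element sets are used. *)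
Definition coloring (N : nat) := {ffun {set 'I_N} -> bool}.

Definition color_class N (c : coloring N) (b : bool) : rel 'I_N :=
  fun i j => (i != j) && (c [set i; j] == b).

Definition has_mono_copy (G : ordered_graph) N (c : coloring N) : bool :=
  [exists b : bool, exists f : {ffun G -> 'I_N},
    is_copy (@edge G) (color_class c b) f].

Definition arrows (G : ordered_graph) (N : nat) : bool :=
  [forall c : coloring N, has_mono_copy G c].

Lemma ramsey_clique (s t : nat) : exists N, forall (T : finType)
    (c : {set T} -> bool) (A : {set T}), N <= #|A| ->
  exists (b : bool) (S : {set T}),
    [/\ S \subset A, #|S| = (if b then s else t)
      & {in S &, forall x y, x != y -> c [set x; y] = b}].
Proof.
have [n] := ubnP (s + t); elim: n s t => // n IHn [|s] [|t] st.
1-3: exists 0 => T c A _.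
- by exists true, set0; rewrite cards0 sub0set; split=> // x y; rewrite inE.
- by exists true, set0; rewrite cards0 sub0set; split=> // x y; rewrite inE.
- by exists false, set0; rewrite cards0 sub0set; split=> // x y; rewrite inE.
have /IHn [N1 HN1] : s + t.+1 < n by rewrite addSn ltnS in st.
have /IHn [N2 HN2] : s.+1 + t < n by rewrite addnS ltnS in st.
exists (N1 + N2).+1 => T c A HA.
have /card_gt0P [x xA] : 0 < #|A| by apply: leq_trans HA.
pose B := A :\ x; pose P := [set y | c [set x; y]].
have HB : N1 + N2 <= #|B :&: P| + #|B :\: P|.
  by rewrite cardsID; move: HA; rewrite (cardsD1 x A) xA.
have BA (S C : {set T}) : S \subset C -> C \subset B -> S \subset A.
  by move=> SC CB; rewrite (subset_trans SC) // (subset_trans CB) // subD1set.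
have xS (S C : {set T}) : S \subset C -> C \subset B -> x \notin S.
  move=> SC CB; apply/negP => /(subsetP SC) /(subsetP CB).
  by rewrite !inE eqxx.
have ext (S : {set T}) b : (forall y, y \in S -> c [set x; y] = b) ->
    {in S &, forall y z, y != z -> c [set y; z] = b} ->
    {in x |: S &, forall y z, y != z -> c [set y; z] = b}.
  move=> Hx HS y z /setU1P [->|yS] /setU1P [->|zS]; rewrite ?eqxx // => yz.
  - exact: Hx.
  - by rewrite setUC Hx.
  - exact: HS.
have sI : B :&: P \subset B by apply: subsetIl.
have sD : B :\: P \subset B by apply: subsetDl.
have [le1|lt1] := leqP N1 #|B :&: P|.
  have [[] [S [SC cS HS]]] := HN1 T c _ le1; last first.
    by exists false, S; split=> //; apply: BA SC sI.
  exists true, (x |: S); rewrite cardsU1 (xS _ _ SC sI) cS; split=> //.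
    by rewrite subUset sub1set xA (BA _ _ SC sI).
  by apply: ext => // y /(subsetP SC); rewrite !inE => /andP [].
have le2 : N2 <= #|B :\: P|.
  by rewrite -(leq_add2l N1); apply: leq_trans HB _; rewrite leq_add2r ltnW.
have [[] [S [SC cS HS]]] := HN2 T c _ le2.
  by exists true, S; split=> //; apply: BA SC sD.
exists false, (x |: S); rewrite cardsU1 (xS _ _ SC sD) cS; split=> //.
  by rewrite subUset sub1set xA (BA _ _ SC sD).
by apply: ext => // y /(subsetP SC); rewrite !inE => /andP [/negbTE].
Qed.

Lemma arrows_exists (G : ordered_graph) : exists N, arrows G N.
Proof.
have [N HN] := ramsey_clique #|G| #|G|; exists N.
apply/forallP => c.
have [|b [S [_ cS HS]]] := HN _ c [set: 'I_N]; first by rewrite cardsT card_ord.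
have cGS : #|G| = #|S| by rewrite cS; case: (b).
pose g (x : G) : 'I_N := Order.enum_val (cast_ord cGS (Order.enum_rank x)).
have gS x : g x \in S by apply: Order.enum_valP.
have g_inj : injective g.
  move=> x y /Order.enum_val_inj /cast_ord_inj; exact: Order.enum_rank_inj.
apply/existsP; exists b; apply/existsP; exists (finfun g).
apply/and3P; split.
- by apply/injectiveP => x y; rewrite !ffunE => /g_inj.
- apply/forallP => x; apply/forallP => y; apply/implyP => xy; rewrite !ffunE.
  rewrite /g Order.le_enum_val; last exact: le_total.
  by rewrite -(Order.le_enum_rank (@le_total _ G)) in xy.
apply/forallP => x; apply/forallP => y; apply/implyP => exy; rewrite !ffunE.
have gxy : g x != g y.
  by apply: contraTneq exy => /g_inj ->; rewrite edge_irrefl.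
by rewrite /color_class gxy HS ?eqxx.
Qed.

Definition R (G : ordered_graph) : nat := ex_minn (arrows_exists G).

(* G' is, up to isomorphism of ordered graphs, G with an isolated vertex w
   added (at an unspecified position of the vertex ordering); f is injective
   because it preserves and reflects <=. *)
Definition adds_isolated (G G' : ordered_graph) (w : G') : Prop :=
  exists f : G -> G',
    [/\ {mono f : x y / (x <= y)%O},
        {mono f : x y / edge x y},
        codom f =i predC1 w
      & forall x, ~~ edge w x].

Definition adds_isolated_right (G G' : ordered_graph) : Prop :=
  exists2 w : G', adds_isolated G w & forall x : G', (x <= w)%O.

Definition adds_isolated_left (G G' : ordered_graph) : Prop :=
  exists2 w : G', adds_isolated G w & forall x : G', (w <= x)%O.

(* Main.v *)
Require Import Defs.
From mathcomp Require Import all_boot all_order.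

Set Implicit Arguments.
Unset Strict Implicit.
Unset Printing Implicit Defensive.

Import Order.TTheory.

(** Let [w] be the new vertex, at one end of [G'], and let [k] be the vertex of
    [m.+1] vertices at the same end.  The other [m] vertices are the image of
    [lift k], so colourings of [m] and of [m.+1] vertices can be compared along
    [lift k].
    - A monochromatic copy of [G] among the vertices other than [k] becomes a
      copy of [G'] by sending [w] to [k]: the order is respected because both
      are at the same end, and [w] has no edge to take care of.
    - In a copy of [G'], the image of [w] lies strictly beyond the image of
      [G] on that side, so the image of [G] avoids [k].  Hence a colouring of
      [m] vertices without a monochromatic [G] has no monochromatic [G'] after
      [k] is joined with edges of any colours.

    Therefore [arrows G' m.+1 = arrows G m] ([arrows_isolatedE]).  Since
    [G'] is nonempty, [arrows G' 0] fails, so the least such numbers differ by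
    exactly 1. *)

Lemma is_copyP d d' (T : finOrderType d) (T' : finOrderType d')
    (e : rel T) (e' : rel T') (f : {ffun T -> T'}) :
  reflect [/\ injective f, {homo f : x y / (x <= y)%O}
            & {homo f : x y / e x y >-> e' x y}]
          (is_copy e e' f).
Proof.
apply: (iffP and3P) => [[/injectiveP fI fle fe]|[fI fle fe]].
  by split=> // x y; apply/implyP;
    [move/forallP: fle | move/forallP: fe] => /(_ x)/forallP; apply.
by split; first exact/injectiveP; do 2![apply/forallP => ?]; apply/implyP; auto.
Qed.

Lemma has_mono_copyP (G : ordered_graph) N (c : coloring N) :
  reflect (exists b (f : {ffun G -> 'I_N}),
             is_copy (@edge G) (color_class c b) f)
          (has_mono_copy G c).
Proof. by apply: (iffP existsP) => -[b] /existsP; exists b. Qed.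

(** Both sides of the ordering are treated at once: [w] and [k] are either the
    two maxima or the two minima. *)
Definition same_end d d' (T : porderType d) (T' : porderType d')
    (w : T) (k : T') : Prop :=
  (forall x, (x <= w)%O) /\ (forall i, (i <= k)%O) \/
  (forall x, (w <= x)%O) /\ (forall i, (k <= i)%O).

(** The image of [w] already lies between [f x] and the end [k], so [f x = k]
    would give [f x = f w]. *)
Lemma same_end_avoid d d' (T : porderType d) (T' : porderType d')
    (w x : T) (k : T') (f : T -> T') :
  same_end w k -> injective f -> {homo f : x y / (x <= y)%O} ->
  x != w -> f x != k.
Proof.
move=> wk fI fle; apply: contra_neq => fxk; apply: fI; apply: le_anti.
case: wk => -[wx ki]; first by rewrite fle // fxk ki.
by rewrite {1}fxk ki fle.
Qed.

Lemma le_lift m (k : 'I_m.+1) :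
  {mono (lift k : 'I_m -> 'I_m.+1) : i j / (i <= j)%O}.
Proof. by move=> i j; rewrite !leEord /= leq_bump2. Qed.

Lemma adds_isolatedP (G G' : ordered_graph) (w : G') :
  adds_isolated G w ->
  exists f : G -> G',
    [/\ injective f, {mono f : x y / (x <= y)%O},
        {mono f : x y / edge x y}, (forall x, f x != w)
      & forall x', x' = w \/ exists x, x' = f x].
Proof.
case=> f [fle fe fw _]; exists f; split=> // [|x|x'].
- exact: inc_inj fle.
- by have := codom_f f x; rewrite fw.
have [->|xw] := eqVneq x' w; first by left.
by right; apply/codomP; rewrite fw.
Qed.

(** In a copy of [G'], all the old vertices avoid [k] by [same_end_avoid], so
    they form a copy of [G] in the other [m] vertices.  The edges at
    [k] can therefore have any colours: preimages under [lift k] give the edge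
    [[set k; lift k i]] the value at the singleton [[set i]]. *)
Lemma arrows_del_isolated (G G' : ordered_graph) (w : G') m (k : 'I_m.+1) :
  adds_isolated G w -> same_end w k -> arrows G' m.+1 -> arrows G m.
Proof.
case/adds_isolatedP=> phi [phiI phi_le phi_e phi_w _] wk /forallP arr.
apply/forallP => c; apply/has_mono_copyP.
pose c' : coloring m.+1 := [ffun S : {set 'I_m.+1} => c (lift k @^-1: S)].
have c'E b i j : color_class c' b (lift k i) (lift k j) = color_class c b i j.
  rewrite /color_class ffunE (inj_eq lift_inj); congr (_ && (c _ == b)).
  by apply/setP => l; rewrite !inE !(inj_eq lift_inj).
have /has_mono_copyP [b [f /is_copyP [fI fle fe]]] := arr c'.
(* A choice of preimages under [lift k]; [m] is not yet known to be positive,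
   so there is no default value in ['I_m] to fall back on. *)
have /fin_all_exists [g gE] x : exists i, f (phi x) = lift k i.
  have := same_end_avoid wk fI fle (phi_w x); rewrite eq_sym.
  by case/unlift_some=> i; exists i.
exists b, (finfun g); apply/is_copyP; split=> [x y|x y xy|x y xy].
- rewrite !ffunE => gxy; apply/phiI/fI.
  by rewrite !gE gxy.
- by rewrite !ffunE -(le_lift k) -!gE fle // phi_le.
by rewrite !ffunE -c'E -!gE fe // phi_e.
Qed.

(** A copy of [G] outside [k] extends by [w] to [k]: extremality of both at the
    same end keeps the map monotone, and [w] brings no edge. *)
Lemma arrows_add_isolated (G G' : ordered_graph) (w : G') m (k : 'I_m.+1) :
  adds_isolated G w -> same_end w k -> arrows G m -> arrows G' m.+1.
Proof.
move=> Gw wk /forallP arr; have [_ [_ _ _ w_isol]] := Gw.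
case/adds_isolatedP: Gw => phi [phiI phi_le phi_e phi_w split_w].
apply/forallP => c; apply/has_mono_copyP.
pose c' : coloring m := [ffun S : {set 'I_m} => c (lift k @: S)].
have c'E b i j : color_class c' b i j = color_class c b (lift k i) (lift k j).
  by rewrite /color_class ffunE (inj_eq lift_inj) imsetU1 imset_set1.
have /has_mono_copyP [b [f /is_copyP [fI fle fe]]] := arr c'.
pose g : {ffun G' -> 'I_m.+1} := [ffun x' : G' =>
  if [pick x | phi x == x'] is Some x then lift k (f x) else k].
have gw : g w = k.
  by rewrite ffunE; case: pickP => // x; rewrite (negbTE (phi_w x)).
have gphi x : g (phi x) = lift k (f x).
  rewrite ffunE; case: pickP => [y /eqP/phiI -> //|/(_ x)].
  by rewrite eqxx.
exists b, g; apply/is_copyP; split=> x' y'.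
- case: (split_w x') (split_w y') => [->|[x ->]] [->|[y ->]] //.
  + by rewrite gw gphi => /eqP; rewrite (negbTE (neq_lift _ _)).
  + by rewrite gw gphi => /esym/eqP; rewrite (negbTE (neq_lift _ _)).
  by rewrite !gphi => /lift_inj/fI ->.
- case: (split_w x') (split_w y') => [->|[x ->]] [->|[y ->]] //; last first.
    by rewrite !gphi phi_le le_lift => /fle.
  (* When [k] is the extremum that the goal asks for, [ki] closes it; otherwise
     the comparison with the extreme vertex [w] would force an equality. *)
  + by case: wk => -[wx ki] xw; rewrite gw ?ki //;
      case/eqP: (phi_w x); apply/le_anti; rewrite xw wx.
  by case: wk => -[wx ki] xw; rewrite gw ?ki //;
    case/eqP: (phi_w y); apply/le_anti; rewrite xw wx.
case: (split_w x') (split_w y') => [->|[x ->]] [->|[y ->]].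
1-2: by rewrite (negbTE (w_isol _)).
- by rewrite edge_sym (negbTE (w_isol _)).
by rewrite !gphi -c'E phi_e => /fe.
Qed.

Lemma arrows_isolatedE (G G' : ordered_graph) m :
  adds_isolated_right G G' \/ adds_isolated_left G G' ->
  arrows G' m.+1 = arrows G m.
Proof.
move=> h; suff [w [k [Gw wk]]] : exists (w : G') (k : 'I_m.+1),
    adds_isolated G w /\ same_end w k.
  by apply/idP/idP;
    [exact: arrows_del_isolated Gw wk | exact: arrows_add_isolated Gw wk].
case: h => -[w Gw wx]; exists w.
  by exists ord_max; split=> //; left; split=> // i; rewrite leEord leq_ord.
by exists ord0; split=> //; right; split=> // i; rewrite leEord.
Qed.

Lemma arrows_gt0 (G : ordered_graph) N : arrows G N -> 0 < N.
Proof.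
move=> /forallP /(_ [ffun=> true]) /has_mono_copyP [b [f _]].
have /card_gt0P [x _] := vertex_nonempty G.
exact: leq_ltn_trans (ltn_ord (f x)).
Qed.

Theorem proposition7 (G G' : ordered_graph)
    (hG' : adds_isolated_right G G' \/ adds_isolated_left G G') :
  R G' = R G + 1.
Proof.
rewrite addn1 /R; case: ex_minnP => n' arr' min'; case: ex_minnP => n arr min.
apply/eqP; rewrite eqn_leq min' ?(arrows_isolatedE _ hG') //=.
case: n' arr' {min'} => [/arrows_gt0 //|m].
by rewrite (arrows_isolatedE _ hG') => /min.
Qed.
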